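(* Consider an $\mathbb{R}^d$-valued random variable $X$ whose components have no point mass, with the natural (componentwise) partial order $\ge$ on $\mathbb{R}^d$. If the components of $X$ are independent, then the partial quantile points satisfy $$x_\tau=q_X\left(\frac{\tau^{1/d}}{\tau^{1/d}+(1-\tau)^{1/d}}\right)\quad\text{and}\quad p_\tau=\frac{1}{(\tau^{1/d}+(1-\tau)^{1/d})^d}\qquad\text{for all }\tau\in(0,1).$$ In particular, $x_{0.5}=q_X(0.5)$, and for any $\ell_\kappa$-norm we have $$\|x_\tau-x_{0.5}\|_\kappa\le\|q_X(\tau)-q_X(0.5)\|_\kappa\qquad\text{for all }\tau\in(0,1).$$
   Context: The partial order is $a\succcurlyeq b$ iff $a_j\ge b_j$ for all $j$. $\mathcal{C}(x)=\{y:y\succcurlyeq x\text{ or }y\preccurlyeq x\}$; $p_x=P(X\in\mathcal{C}(x))$; for $\tau\in(0,1)$, $\mathcal{Q}(\tau)=\{x:P(X\succcurlyeq x\mid X\in\mathcal{C}(x))\ge1-\tau,\ P(X\preccurlyeq x\mid X\in\mathcal{C}(x))\ge\tau\}$; a $\tau$-partial quantile point $x_\tau$ is a maximizer of $p_x$ over $x\in\mathcal{Q}(\tau)$, and $p_\tau=p_{x_\tau}$. $q_X(\tau)=(q_{X_1}(\tau),\dots,q_{X_d}(\tau))'$ is the vector whose components are the (univariate) $\tau$-quantiles of the components of $X$. *)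

(* Defs.v *)
From HB Require Import structures.
From mathcomp Require Import all_boot all_order all_algebra.
From mathcomp Require Import all_classical all_reals all_analysis.
Set Implicit Arguments.
Unset Strict Implicit.
Unset Printing Implicit Defensive.
Import Order.TTheory GRing.Theory Num.Theory.
Import numFieldNormedType.Exports.
Local Open Scope classical_set_scope.
Local Open Scope ring_scope.

(* R^d is [d.-tuple R], which carries the product
   sigma-algebra, so that [{RV P >-> d.-tuple R}] is a random vector. *)

Definition vle (R : realType) (d : nat) (a b : d.-tuple R) : Prop :=
  forall j : 'I_d, tnth a j <= tnth b j.

Definition comparable_set (R : realType) (d : nat) (x : d.-tuple R) :
    set (d.-tuple R) :=
  [set y | vle x y \/ vle y x].

(* For [P B = 0] the value is 0, because [r / 0 = 0]. *)
Definition cond_prob (R : realType) (dT : measure_display)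
    (T : measurableType dT) (P : probability T R) (A B : set T) : R :=
  fine (P (A `&` B)) / fine (P B).

Section PartialQuantile.
Context (R : realType) (dT : measure_display) (T : measurableType dT)
  (P : probability T R) (d : nat) (X : {RV P >-> d.-tuple R}).

Definition coordinate (j : 'I_d) : T -> R := fun w => tnth (X w) j.

Definition no_point_mass : Prop :=
  forall (j : 'I_d) (t : R), P (coordinate j @^-1` [set t]) = 0%E.

Definition independent_components : Prop :=
  forall (J : {set 'I_d}) (B : 'I_d -> set R),
    (forall j, measurable (B j)) ->
    P [set w | forall j, j \in J -> B j (coordinate j w)] =
    (\prod_(j in J) P (coordinate j @^-1` B j))%E.

Definition comparable_prob (x : d.-tuple R) : R :=
  fine (P (X @^-1` comparable_set x)).

(* By the convention on [cond_prob], for [0 < tau < 1] every [x] in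
   [Qset tau] has [comparable_prob x > 0], i.e. both conditional probabilities are
   genuine. *)
Definition Qset (tau : R) : set (d.-tuple R) :=
  [set x |
    1 - tau <= cond_prob P [set w | vle x (X w)] (X @^-1` comparable_set x) /\
    tau <= cond_prob P [set w | vle (X w) x] (X @^-1` comparable_set x)].

Definition partial_quantile_point (tau : R) (x : d.-tuple R) : Prop :=
  Qset tau x /\ forall y, Qset tau y -> comparable_prob y <= comparable_prob x.

(* Univariate quantiles need not be unique: the distribution function of an
   atomless variable may be constant on an interval. *)
Definition is_quantile (Y : T -> R) (u t : R) : Prop :=
  ((1 - u)%:E <= P [set w | (t <= Y w)%R])%E /\
  (u%:E <= P [set w | (Y w <= t)%R])%E.

Definition is_quantile_vector (u : R) (x : d.-tuple R) : Prop :=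
  forall j : 'I_d, is_quantile (coordinate j) u (tnth x j).

(* A version of the map [u |-> q_X(u)] on ]0, 1[, the choice among several
   quantiles of a component being arbitrary. *)
Definition quantile_function (q : R -> d.-tuple R) : Prop :=
  forall u, 0 < u < 1 -> is_quantile_vector u (q u).

End PartialQuantile.

Definition root_sum (R : realType) (d : nat) (tau : R) : R :=
  tau `^ (d%:R^-1) + (1 - tau) `^ (d%:R^-1).

Definition quantile_level (R : realType) (d : nat) (tau : R) : R :=
  tau `^ (d%:R^-1) / root_sum d tau.

(* The distance [ ||x - y||_k ] for [1 <= k <= +oo]; the value at [-oo] is
   never used. *)
Definition ell_dist (R : realType) (d : nat) (k : \bar R)
    (x y : d.-tuple R) : R :=
  match k with
  | r%:E => (\sum_(j < d) `|tnth x j - tnth y j| `^ r) `^ r^-1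
  | +oo%E => \big[Num.max/0]_(j < d) `|tnth x j - tnth y j|
  | -oo%E => 0
  end.

(* Main.v *)
(* For independent atomless components with distribution functions F_j, put
   B = prod_j F_j(x_j) = P(X <= x) and A = prod_j (1 - F_j(x_j)) = P(X >= x);
   then p_x = A + B, and x lies in Q(tau) iff A = (1 - tau) p_x, B = tau p_x and
   p_x > 0. By AM-GM, B^(1/d) and A^(1/d) are at most the means of the F_j(x_j)
   and of the 1 - F_j(x_j), which add up to 1, so on Q(tau)
   p_x (tau^(1/d) + (1 - tau)^(1/d))^d <= 1, with equality iff all F_j(x_j)
   coincide, their common value being tau^(1/d) / (tau^(1/d) + (1 - tau)^(1/d)).
   This level lies between tau and 1/2, so the norm inequality follows
   componentwise from the monotonicity of quantiles. *)
Require Import Defs.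
From HB Require Import structures.
From mathcomp Require Import all_boot all_order all_algebra.
From mathcomp Require Import all_classical all_reals all_analysis.
From mathcomp Require Import ring lra.
Set Implicit Arguments.
Unset Strict Implicit.
Import Order.TTheory GRing.Theory Num.Theory.
Import numFieldNormedType.Exports.
Local Open Scope classical_set_scope.
Local Open Scope ring_scope.

(** * The AM-GM bound and its equality case *)

Lemma powR_invnK {R : realType} (n : nat) (x : R) :
  (0 < n)%N -> 0 <= x -> (x `^ n%:R^-1) ^+ n = x.
Proof.
move=> n0 x0; rewrite -powR_mulrn ?powR_ge0// -powRrM mulVf ?powRr1//.
by rewrite pnatr_eq0 -lt0n.
Qed.

(** Meant for [E j] = F_j(x_j), [p] = p_x and [a], [b] the d-th roots of tau and 1 - tau. With [c]
    the d-th root of [p] and [m] the mean of [E], AM-GM gives [a * c <= m] and [b * c <= 1 - m]; the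
    two are added. *)
Lemma prod_compl_le {R : realType} (d : nat) (E : 'I_d -> R) (a b p : R) :
  (0 < d)%N -> (forall j, 0 <= E j <= 1) -> 0 <= a -> 0 <= b -> 0 <= p ->
  \prod_j E j = a ^+ d * p -> \prod_j (1 - E j) = b ^+ d * p ->
  (a + b) ^+ d * p <= 1 ?= iff [forall j, E j == a / (a + b)].
Proof.
move=> d0 E01 a0 b0 p0 prodE prodE'; set c := p `^ d%:R^-1.
have c0 : 0 <= c by exact: powR_ge0.
have cp : c ^+ d = p by exact: powR_invnK.
have d0R : d%:R != 0 :> R by rewrite pnatr_eq0 -lt0n.
set m := (\sum_j E j) / d%:R.
have dmean : (\sum_j (1 - E j)) / d%:R = 1 - m.
  by rewrite sumrB sumr_const card_ord mulrBl mulfV.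
have m0 : 0 <= m.
  by rewrite divr_ge0// sumr_ge0// => j _; case/andP: (E01 j).
have m1 : 0 <= 1 - m.
  rewrite -dmean divr_ge0// sumr_ge0// => j _.
  by case/andP: (E01 j); rewrite subr_ge0.
have [E0 E1] : {in 'I_d, forall j, 0 <= E j} /\ {in 'I_d, forall j, 0 <= 1 - E j}.
  by split=> j _; case/andP: (E01 j); rewrite ?subr_ge0.
have [agm agm_eq] := leif_AGM E0.
have [agm' _] := leif_AGM E1.
rewrite !card_ord -/m in agm agm_eq; rewrite !card_ord dmean in agm'.
rewrite prodE -cp -exprMn in agm agm_eq; rewrite prodE' -cp -exprMn in agm'.
have le1 : a * c <= m by rewrite -(ler_pXn2r d0) ?nnegrE// mulr_ge0.
have le2 : b * c <= 1 - m by rewrite -(ler_pXn2r d0) ?nnegrE// mulr_ge0.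
have ab0 : 0 <= a + b by exact: addr_ge0.
split.
  rewrite -cp -exprMn; apply: exprn_ile1; first exact: mulr_ge0.
  by rewrite mulrDl; lra.
apply/eqP/forallP => [eq1 j|/(_ _)/eqP Eab].
  have abc : (a + b) * c = 1.
    apply/eqP; rewrite -(eqrXn2 d0) ?mulr_ge0 ?ler01//.
    by rewrite exprMn cp eq1 expr1n.
  have ab_n0 : a + b != 0.
    by apply: contra_eq_neq abc => ->; rewrite mul0r eq_sym oner_neq0.
  (* The bounds [le1] and [le2] sum to 1 on the right, and by [abc] also on the left, so neither is
     strict. AM-GM for [E] is then an equality, which makes [E] constant. *)
  have acm : a * c = m by apply/eqP; rewrite eq_le le1/=; move: abc; rewrite mulrDl; lra.
  have Ec : forall i, E i = E j.
    move: agm_eq; rewrite acm eqxx => /esym/forall_inP Eij i.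
    by have /forall_inP/(_ j isT)/eqP := Eij i isT.
  have -> : E j = m.
    rewrite /m (eq_bigr _ (fun i _ => Ec i)) sumr_const card_ord.
    by rewrite -[_ *+ _ in RHS]mulr_natr mulfK.
  rewrite -acm; apply/eqP; apply: (mulIf ab_n0).
  by rewrite divfK// -mulrA [c * _]mulrC abc mulr1.
(* If [a + b] vanished, division by zero would make every [E j] equal to 0, so the product of the
   [1 - E j] would be 1, against [b ^+ d * p = 0]. *)
have ab_n0 : a + b != 0.
  apply/eqP => ab_eq0.
  have a_eq0 : a = 0 by lra.
  have b_eq0 : b = 0 by lra.
  move: prodE'; rewrite b_eq0 expr0n gtn_eqF//= mul0r.
  rewrite big1 => [/eqP|j _]; first by rewrite oner_eq0.
  by rewrite Eab a_eq0 mul0r subr0.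
(* Adding the two product hypotheses for the constant [E] determines [p], once the nonzero factor
   [a ^+ d + b ^+ d] is cancelled. *)
have : (a ^+ d + b ^+ d) * p * (a + b) ^+ d = a ^+ d + b ^+ d.
  rewrite mulrDl -prodE -prodE'.
  under eq_bigr => j _ do rewrite Eab.
  under [X in _ + X]eq_bigr => j _.
    rewrite Eab (_ : 1 - _ = b / (a + b)); last by field.
    over.
  rewrite !prodr_const card_ord !expr_div_n mulrDl !divfK ?expf_neq0//.
suff sum_n0 : a ^+ d + b ^+ d != 0.
  by rewrite -mulrA [p * _]mulrC => h; apply: (mulfI sum_n0); rewrite mulr1.
have := addr_ge0 a0 b0; rewrite le0r (negbTE ab_n0)/= => ab_gt0.
have [a_eq0|a_n0] := eqVneq a 0.
  move: ab_n0; rewrite a_eq0 add0r expr0n gtn_eqF//= add0r => b_n0.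
  by rewrite expf_neq0.
apply: lt0r_neq0; apply: ltr_pwDl; last exact: exprn_ge0.
by rewrite exprn_gt0// lt_neqAle eq_sym a_n0.
Qed.

(** * The level tau^(1/d) / (tau^(1/d) + (1 - tau)^(1/d)) as a bijection of ]0, 1[ *)

Section QuantileLevel.
Context {R : realType} (d : nat) (d0 : (0 < d)%N).
Implicit Types tau u v c : R.

Lemma root_sum_gt0 tau : 0 < tau < 1 -> 0 < root_sum d tau.
Proof. by case/andP=> t0 t1; rewrite addr_gt0// powR_gt0// subr_gt0. Qed.

Lemma quantile_level_gt0_lt1 tau : 0 < tau < 1 -> 0 < quantile_level d tau < 1.
Proof.
move=> t01; have rs0 := root_sum_gt0 t01; have /andP[t0 t1] := t01.
rewrite /quantile_level divr_gt0 ?powR_gt0//= ltr_pdivrMr// mul1r ltrDl.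
by rewrite powR_gt0// subr_gt0.
Qed.

Lemma quantile_levelC tau : 0 < tau < 1 ->
  1 - quantile_level d tau = (1 - tau) `^ d%:R^-1 / root_sum d tau.
Proof.
move=> /root_sum_gt0/lt0r_neq0 rs_n0; apply: (mulIf rs_n0).
by rewrite mulrBl mul1r !divfK// /root_sum addrAC subrr add0r.
Qed.

Lemma quantile_levelXn tau : 0 < tau < 1 ->
  quantile_level d tau ^+ d = tau / root_sum d tau ^+ d.
Proof. by case/andP=> /ltW t0 _; rewrite expr_div_n powR_invnK. Qed.

Lemma quantile_levelCXn tau : 0 < tau < 1 ->
  (1 - quantile_level d tau) ^+ d = (1 - tau) / root_sum d tau ^+ d.
Proof.
move=> t01; rewrite quantile_levelC// expr_div_n powR_invnK// subr_ge0.
by case/andP: t01 => _ /ltW.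
Qed.

(** Taking d-th roots, [u] and [1 - u] are the roots of [tau] and [1 - tau] times one common factor;
    since they add up to 1, normalizing the roots gives back [u]. *)
Lemma quantile_levelP tau u c : 0 < tau < 1 -> 0 <= u <= 1 -> 0 < c ->
  u ^+ d = tau * c -> (1 - u) ^+ d = (1 - tau) * c -> quantile_level d tau = u.
Proof.
move=> t01 /andP[u0 u1] c0 ud vd; have /andP[t0 t1] := t01.
have [c' c'0 c'd] : exists2 c', 0 < c' & c' ^+ d = c.
  by exists (c `^ d%:R^-1); rewrite ?powR_gt0// powR_invnK// ltW.
have root v t : 0 <= v -> 0 < t -> v ^+ d = t * c -> t `^ d%:R^-1 = v / c'.
  move=> v0 t_gt0 vdE; apply/eqP.
  rewrite -(eqrXn2 d0) ?powR_ge0 ?divr_ge0// ?ltW// powR_invnK ?(ltW t_gt0)//.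
  by rewrite expr_div_n c'd vdE mulfK// gt_eqF.
rewrite /quantile_level /root_sum (root u)// (root (1 - u)) ?subr_ge0 ?subr_gt0//.
by field; rewrite gt_eqF//= addrC subrK oner_eq0.
Qed.

Lemma quantile_level_half : quantile_level d 2^-1 = 2^-1 :> R.
Proof.
have h : 0 < (2^-1 : R) < 1 by apply/andP; split; lra.
(* The factor is forced by [u ^+ d = tau * c] at [u] = [tau] = 1/2. *)
apply: (@quantile_levelP _ _ (2^-1 ^+ d / 2^-1)) => //.
- by case/andP: h => /ltW -> /ltW.
- by field.
- by rewrite (_ : 1 - 2^-1 = 2^-1); [field | lra].
Qed.

(** Solves tau : (1 - tau) = u^d : (1 - u)^d for tau. It serves to reindex a family of partial
    quantile points by quantile levels. *)
Definition inv_quantile_level u : R := u ^+ d / (u ^+ d + (1 - u) ^+ d).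

Lemma inv_quantile_level_gt0_lt1 u : 0 < u < 1 -> 0 < inv_quantile_level u < 1.
Proof.
case/andP=> u0 u1; have ud := exprn_gt0 d u0.
have vd : 0 < (1 - u) ^+ d by rewrite exprn_gt0// subr_gt0.
by rewrite divr_gt0 ?addr_gt0//= ltr_pdivrMr ?addr_gt0// mul1r ltrDl.
Qed.

Lemma inv_quantile_levelK u : 0 < u < 1 ->
  quantile_level d (inv_quantile_level u) = u.
Proof.
move=> u01; have /andP[u0 u1] := u01; have ud := exprn_gt0 d u0.
have vd : 0 < (1 - u) ^+ d by rewrite exprn_gt0// subr_gt0.
apply: (@quantile_levelP _ _ (u ^+ d + (1 - u) ^+ d)) => //.
- exact: inv_quantile_level_gt0_lt1.
- by rewrite !ltW.
- exact: addr_gt0.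
- by rewrite divfK// gt_eqF// addr_gt0.
- by rewrite mulrBl divfK ?mul1r ?gt_eqF ?addr_gt0// addrAC subrr add0r.
Qed.

Lemma quantile_levelK tau : 0 < tau < 1 ->
  inv_quantile_level (quantile_level d tau) = tau.
Proof.
move=> t01; have rs0 := lt0r_neq0 (root_sum_gt0 t01).
rewrite /inv_quantile_level quantile_levelXn// quantile_levelCXn//.
by rewrite -mulrDl addrC subrK mul1r mulfK// invr_eq0 expf_neq0.
Qed.

(** With [a], [b] the d-th roots of [tau] and [1 - tau], both bounds come from [b <= a]: the upper
    one, after clearing denominators, is [b ^+ d.-1 <= a ^+ d.-1] times [a * b]. *)
Lemma quantile_level_ge_half tau : 2^-1 <= tau -> tau < 1 ->
  2^-1 <= quantile_level d tau <= tau.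
Proof.
move=> th t1; have t0 : 0 < tau by apply: lt_le_trans th; lra.
have t01 : 0 < tau < 1 by rewrite t0.
have rs0 := root_sum_gt0 t01.
set a := tau `^ d%:R^-1; set b := (1 - tau) `^ d%:R^-1.
have [a0 b0] : 0 < a /\ 0 < b by rewrite !powR_gt0// subr_gt0.
have ba : b <= a by rewrite ge0_ler_powR ?nnegrE ?invr_ge0//; lra.
have ad : a ^+ d = tau by rewrite powR_invnK// ltW.
have bd : b ^+ d = 1 - tau by rewrite powR_invnK// subr_ge0 ltW.
rewrite /quantile_level -/a /root_sum -/a -/b; apply/andP; split.
  by rewrite ler_pdivlMr ?addr_gt0//; lra.
rewrite ler_pdivrMr ?addr_gt0// mulrDr -lerBlDl.
rewrite (_ : a - tau * a = a * b * b ^+ d.-1); last first.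
  by rewrite -mulrA -exprS prednK// bd; ring.
rewrite (_ : tau * b = a * b * a ^+ d.-1); last first.
  by rewrite mulrAC -exprS prednK// ad.
(* For d = 1 both powers are 1 and the level is [tau] itself. *)
have [->|k_gt0] := posnP d.-1; first by rewrite !expr0.
by rewrite ler_pM2l ?mulr_gt0// ler_pXn2r// nnegrE ltW.
Qed.

Lemma quantile_level_sym tau :
  0 < tau < 1 -> quantile_level d (1 - tau) = 1 - quantile_level d tau.
Proof.
move=> t01; rewrite quantile_levelC// /quantile_level /root_sum.
by rewrite subKr [X in _ / X]addrC.
Qed.

Lemma quantile_level_le_half tau : 0 < tau -> tau <= 2^-1 ->
  tau <= quantile_level d tau <= 2^-1.
Proof.
move=> t0 th; have /andP[] : 2^-1 <= quantile_level d (1 - tau) <= 1 - tau.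
  by apply: quantile_level_ge_half; lra.
by rewrite quantile_level_sym; [lra | apply/andP; split; lra].
Qed.

End QuantileLevel.

(** * Monotonicity of the norms in the coordinates *)

Lemma ell_dist_le {R : realType} (d : nat) (k : \bar R) (x y x' y' : d.-tuple R) :
  (1 <= k)%E ->
  (forall j, `|tnth x j - tnth y j| <= `|tnth x' j - tnth y' j|) ->
  ell_dist k x y <= ell_dist k x' y'.
Proof.
case: k => [r||]//= r1 le_xy; last by apply: le_bigmax2.
have r0 : 0 <= r by rewrite (le_trans ler01).
apply: ge0_ler_powR; rewrite ?invr_ge0 ?nnegrE//.
- by apply: sumr_ge0 => j _; exact: powR_ge0.
- by apply: sumr_ge0 => j _; exact: powR_ge0.
by apply: ler_sum => j _; apply: ge0_ler_powR; rewrite ?nnegrE.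
Qed.

(** * Univariate quantiles: existence, and the atomless case *)

Section Quantiles.
Context {R : realType} {dT : measure_display} {T : measurableType dT}
  {P : probability T R}.
Implicit Types Y : {RV P >-> R}.

Lemma cdfE Y t : cdf Y t = P [set w | Y w <= t].
Proof. by rewrite /cdf /distribution /pushforward; congr (P _). Qed.

Lemma measurable_RV_ge Y t : measurable [set w | t <= Y w].
Proof.
have <- : Y @^-1` `[t, +oo[ = [set w | t <= Y w].
  by apply/seteqP; split=> w /=; rewrite in_itv/= andbT.
exact: measurable_funPTI.
Qed.

Lemma measurable_RV_le Y t : measurable [set w | Y w <= t].
Proof.
have <- : Y @^-1` `]-oo, t] = [set w | Y w <= t].
  by apply/seteqP; split=> w /=; rewrite in_itv.
exact: measurable_funPTI.
Qed.

Lemma cdf_ge_right_limit Y (c : \bar R) t :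
  (forall s, t < s -> (c <= cdf Y s)%E) -> (c <= cdf Y t)%E.
Proof.
move=> cY; have Yt := @cdf_right_continuous _ _ _ _ Y t.
apply: (@cvge_ge _ _ _ _ _ _ _ _ Yt).
by near=> s; apply: cY; near: s; exact: nbhs_right_gt.
Unshelve. all: by end_near. Qed.

(** Turns the upper tail P(Y >= t) into a distribution function value, so that right continuity
    applies to it as well. *)
Definition RV_opp Y : T -> R := fun w => - Y w.

Lemma measurable_RV_opp Y : measurable_fun setT (RV_opp Y).
Proof. exact: measurableT_comp. Qed.

HB.instance Definition _ Y :=
  isMeasurableFun.Build _ _ _ _ (RV_opp Y) (measurable_RV_opp Y).

(** The quantile is the infimum of [S], which is nonempty and bounded below because the distribution
    function tends to 1 > u and to 0 < u at the two ends. *)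
Lemma quantile_exists Y u : 0 < u < 1 -> exists t, is_quantile P Y u t.
Proof.
case/andP=> u0 u1; pose S := [set s | (u%:E <= cdf Y s)%E].
have S0 : S !=set0.
  apply/set0P/negP => /eqP S_empty; move: u1; rewrite -lte_fin ltNge => /negP; apply.
  apply: (@cvge_le _ _ _ _ _ _ _ _ (cvg_cdfy1 Y)); apply: nearW => s.
  rewrite leNgt; apply/negP => us; suff : S s by rewrite S_empty.
  exact: ltW.
have Slb : has_lbound S.
  have [s us] : exists s, (cdf Y s < u%:E)%E.
    apply: contrapT => /forallNP geu; move: u0; rewrite -lte_fin ltNge => /negP; apply.
    apply: (@cvge_ge _ _ _ _ _ _ _ _ (cvg_cdfNy0 Y)); apply: nearW => s.
    by rewrite leNgt; apply/negP/geu.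
  exists s => r /= ur; rewrite leNgt; apply/negP => rs.
  have := lt_le_trans us ur.
  by rewrite ltNge cdf_nondecreasing// ltW.
exists (inf S); split; last first.
  rewrite -cdfE; apply: cdf_ge_right_limit => s Ss.
  have s0 : 0 < s - inf S by rewrite subr_gt0.
  have [r Sr] := inf_adherent s0 (conj S0 Slb).
  rewrite addrC subrK => /ltW rs.
  exact: (le_trans Sr (cdf_nondecreasing Y rs)).
(* By right continuity for -Y it suffices to bound P(-Y <= s) for s > - inf S. Then -s lies below
   [inf S], hence outside [S], so P(Y > -s) is at least 1 - u. *)
have -> : P [set w | inf S <= Y w] = cdf (RV_opp Y : {RV P >-> R}) (- inf S).
  by rewrite cdfE; congr (P _); apply/seteqP; split=> w /=; rewrite lerN2.
apply: cdf_ge_right_limit => s; rewrite ltrNl => sS.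
have Fs : (cdf Y (- s) <= u%:E)%E.
  rewrite leNgt; apply/negP => us.
  have : S (- s) by exact: ltW.
  by move=> /(ge_inf Slb); rewrite leNgt sS.
rewrite EFinB (@le_trans _ _ (ccdf Y (- s)))//.
  by rewrite ccdf_1_cdf leeB.
rewrite cdfE /ccdf /distribution /pushforward.
apply: le_measure; rewrite ?inE; [exact: measurable_funPTI|exact: measurable_RV_le|].
by move=> w /=; rewrite in_itv/= andbT lerNl => /ltW.
Qed.

Section Atomless.
Context (Y : {RV P >-> R}) (Y_atomless : forall t, P (Y @^-1` [set t]) = 0%E).

Lemma prob_ge_atomless t : P [set w | t <= Y w] = (1 - cdf Y t)%E.
Proof.
rewrite -ccdf_1_cdf /ccdf /distribution /pushforward.
have -> : [set w | t <= Y w] = Y @^-1` [set t] `|` Y @^-1` `]t, +oo[.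
  apply/seteqP; split=> w /=; rewrite in_itv/= andbT le_eqVlt.
    by case/orP=> [/eqP ->|]; [left|right].
  by case=> ->; rewrite ?eqxx ?orbT.
rewrite measureU; [|exact: measurable_funPTI..|].
  by rewrite [X in (X + _)%E](_ : _ = 0%E) ?add0e//; exact: Y_atomless.
by apply/seteqP; split=> w //= [->]; rewrite in_itv/= ltxx.
Qed.

(** Without atoms the two defining inequalities read 1 - u <= 1 - F(t) and u <= F(t). *)
Lemma is_quantile_atomless u t : is_quantile P Y u t <-> fine (cdf Y t) = u.
Proof.
rewrite /is_quantile prob_ge_atomless -cdfE.
rewrite -[cdf Y t]fineK ?fin_num_measure// !lee_fin /=.
split=> [[]|->]; last by rewrite !lexx.
by rewrite lerD2l lerN2 => h1 h2; apply/eqP; rewrite eq_le h1.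
Qed.

End Atomless.
End Quantiles.

(** * Orthant probabilities and partial quantile points of a random vector *)

Section RandomVector.
Context {R : realType} {dT : measure_display} {T : measurableType dT}
  {P : probability T R} {d : nat} (X : {RV P >-> d.-tuple R}).

Lemma measurable_coordinate j : measurable_fun setT (coordinate X j).
Proof. exact: (measurableT_comp (measurable_tnth j)). Qed.

HB.instance Definition _ j :=
  isMeasurableFun.Build _ _ _ _ (coordinate X j) (measurable_coordinate j).

Definition margin (j : 'I_d) : {RV P >-> R} := coordinate X j.

Definition margin_cdf j t : R := fine (cdf (margin j) t).

Lemma margin_cdf01 j t : 0 <= margin_cdf j t <= 1.
Proof.
rewrite /margin_cdf; have := cdf_ge0 (margin j) t; have := cdf_le1 (margin j) t.
by rewrite -[cdf _ _]fineK ?fin_num_measure// !lee_fin => -> ->.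
Qed.

Lemma margin_cdf_le j s t : s <= t -> margin_cdf j s <= margin_cdf j t.
Proof. by move=> st; rewrite fine_le ?fin_num_measure// cdf_nondecreasing. Qed.

Lemma is_quantile_vectorP u x : no_point_mass X ->
  is_quantile_vector X u x <-> forall j, margin_cdf j (tnth x j) = u.
Proof.
move=> Xatom; split=> h j; first exact/(is_quantile_atomless (Xatom j))/h.
by apply/(@is_quantile_atomless _ _ _ _ (margin j) (Xatom j)); exact: h.
Qed.

Lemma quantile_vector_exists u : 0 < u < 1 -> exists x, is_quantile_vector X u x.
Proof.
move=> u01; have /choice[f fP] := fun j => quantile_exists (margin j) u01.
by exists [tuple f j | j < d] => j; rewrite tnth_mktuple; exact: fP.
Qed.

Context (d0 : (0 < d)%N) (Xatom : no_point_mass X)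
  (Xindep : independent_components X).

Lemma prob_vle x :
  fine (P [set w | vle (X w) x]) = \prod_j margin_cdf j (tnth x j).
Proof.
have /(Xindep [set: 'I_d]%SET) : forall j, measurable `]-oo, tnth x j] by [].
have -> : [set w | forall j, j \in [set: 'I_d]%SET ->
    `]-oo, tnth x j]%classic (coordinate X j w)] = [set w | vle (X w) x].
  apply/seteqP; split=> w /= h j.
    by have := h j (finset.in_setT _); rewrite /= in_itv.
  by move=> _; rewrite in_itv /=; exact: h.
move=> ->; transitivity (fine (\prod_j (margin_cdf j (tnth x j))%:E));
  last by rewrite prodEFin.
congr fine; apply: eq_big => j; first by rewrite finset.in_setT.
move=> _ /=.
by rewrite /margin_cdf fineK ?fin_num_measure.
Qed.

(** Independence is applied to closed upper half-lines; absence of atoms turns each factor P(X_j >=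
    x_j) into 1 - F_j(x_j). *)
Lemma prob_vge x :
  fine (P [set w | vle x (X w)]) = \prod_j (1 - margin_cdf j (tnth x j)).
Proof.
have /(Xindep [set: 'I_d]%SET) : forall j, measurable `[tnth x j, +oo[ by [].
have -> : [set w | forall j, j \in [set: 'I_d]%SET ->
    `[tnth x j, +oo[%classic (coordinate X j w)] = [set w | vle x (X w)].
  apply/seteqP; split=> w /= h j.
    by have := h j (finset.in_setT _); rewrite /= in_itv/= andbT.
  by move=> _; rewrite in_itv /= andbT; exact: h.
move=> ->; transitivity (fine (\prod_j (1 - margin_cdf j (tnth x j))%:E));
  last by rewrite prodEFin.
congr fine; apply: eq_big => j; first by rewrite finset.in_setT.
move=> _ /=.
rewrite EFinB /margin_cdf fineK ?fin_num_measure//.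
rewrite -(prob_ge_atomless (Xatom j)); congr (P _).
by apply/seteqP; split=> w /=; rewrite in_itv/= andbT.
Qed.

Lemma measurable_vle x : measurable [set w | vle (X w) x].
Proof.
have -> : [set w | vle (X w) x] = \bigcap_(j in setT) [set w | margin j w <= tnth x j].
  by apply/seteqP; split=> w /= h j; [move=> _; exact: h|exact: (h j I)].
by apply: fin_bigcap_measurable => // j _; exact: measurable_RV_le.
Qed.

Lemma measurable_vge x : measurable [set w | vle x (X w)].
Proof.
have -> : [set w | vle x (X w)] = \bigcap_(j in setT) [set w | tnth x j <= margin j w].
  by apply/seteqP; split=> w /= h j; [move=> _; exact: h|exact: (h j I)].
by apply: fin_bigcap_measurable => // j _; exact: measurable_RV_ge.
Qed.

Lemma comparable_probE x : comparable_prob X x =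
  \prod_j (1 - margin_cdf j (tnth x j)) + \prod_j margin_cdf j (tnth x j).
Proof.
rewrite -prob_vge -prob_vle -fineD ?fin_num_measure//;
  [|exact: measurable_vge|exact: measurable_vle].
have mge := measurable_vge x; have mle := measurable_vle x.
congr fine; rewrite (_ : _ @^-1` _ = [set w | vle x (X w)] `|` [set w | vle (X w) x])//.
rewrite measureUfinr ?ltey_eq ?fin_num_measure// [X in (_ - X)%E](_ : _ = 0%E) ?sube0//.
(* The two orthants meet only where X = x, inside the null event that one coordinate equals that of
   [x]; [d0] supplies the coordinate. *)
pose j0 := Ordinal d0; apply: (subset_measure0 _ _ _ (Xatom j0 (tnth x j0))).
- exact: measurableI.
- exact: (measurable_funPTI (margin j0)).
- by move=> w [/= h1 h2]; apply/eqP; rewrite eq_le h1 h2.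
Qed.

(** The two conditional probabilities add up to 1, as do their lower bounds 1 - tau and tau, so both
    inequalities are equalities. *)
Lemma QsetP tau x : 0 < tau -> Qset X tau x <->
  [/\ 0 < comparable_prob X x,
      \prod_j (1 - margin_cdf j (tnth x j)) = (1 - tau) * comparable_prob X x &
      \prod_j margin_cdf j (tnth x j) = tau * comparable_prob X x].
Proof.
move=> t0; have pE := comparable_probE x.
rewrite /Qset/= /cond_prob -/(comparable_prob X x).
have -> : [set w | vle x (X w)] `&` X @^-1` comparable_set x = [set w | vle x (X w)].
  by apply/setIidPl => w /=; left.
have -> : [set w | vle (X w) x] `&` X @^-1` comparable_set x = [set w | vle (X w) x].
  by apply/setIidPl => w /=; right.
rewrite prob_vge prob_vle; set A := \prod_j (1 - _); set B := \prod_j _.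
have p_ge0 : 0 <= comparable_prob X x by exact: fine_ge0.
split=> [[leA leB]|[p0 -> ->]]; last by rewrite !mulfK ?gt_eqF.
(* Were it 0, the convention [r / 0 = 0] would give [tau <= 0]. *)
have p0 : 0 < comparable_prob X x.
  rewrite lt_neqAle p_ge0 andbT; apply/eqP => p_eq0.
  by move: leB; rewrite -p_eq0 invr0 mulr0 leNgt t0.
move: leA leB; rewrite !ler_pdivlMr// => leA leB.
rewrite -/A -/B in pE; rewrite mulrBl mul1r in leA *.
by split=> //; lra.
Qed.

Lemma Qset_comparable_prob_le tau x : 0 < tau < 1 -> Qset X tau x ->
  root_sum d tau ^+ d * comparable_prob X x <= 1
    ?= iff [forall j, margin_cdf j (tnth x j) == quantile_level d tau].
Proof.
move=> /andP[t0 t1] /(QsetP x t0)[p0 vge_x vle_x].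
apply: prod_compl_le; rewrite ?powR_ge0 ?(ltW p0) ?powR_invnK ?subr_ge0 ?ltW//.
by move=> j; exact: margin_cdf01.
Qed.

Lemma Qset_quantile_vector tau x : 0 < tau < 1 ->
  is_quantile_vector X (quantile_level d tau) x -> Qset X tau x.
Proof.
move=> t01; have /andP[t0 t1] := t01; move/(is_quantile_vectorP _ _ Xatom) => Fx.
set u := quantile_level d tau in Fx.
have prodF : \prod_j margin_cdf j (tnth x j) = u ^+ d.
  by rewrite (eq_bigr (fun=> u))// prodr_const card_ord.
have prodFC : \prod_j (1 - margin_cdf j (tnth x j)) = (1 - u) ^+ d.
  by rewrite (eq_bigr (fun=> 1 - u)) ?prodr_const ?card_ord// => j _; rewrite Fx.
have := comparable_probE x; rewrite (QsetP x t0) prodF prodFC.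
rewrite quantile_levelXn// quantile_levelCXn//.
rewrite -mulrDl subrK mul1r => ->.
by rewrite invr_gt0 exprn_gt0// root_sum_gt0.
Qed.

(** Quantile vectors at this level exist, lie in Q(tau) and attain the AM-GM bound, so they are
    maximizers; any other maximizer attains it too and falls under the equality case. *)
Lemma partial_quantile_pointP tau x : 0 < tau < 1 ->
  partial_quantile_point X tau x <->
  is_quantile_vector X (quantile_level d tau) x.
Proof.
move=> t01; have rsd0 : 0 < root_sum d tau ^+ d by rewrite exprn_gt0// root_sum_gt0.
have quantile_max z : is_quantile_vector X (quantile_level d tau) z ->
    root_sum d tau ^+ d * comparable_prob X z = 1.
  move=> zq; apply/eqP; rewrite (Qset_comparable_prob_le t01 (Qset_quantile_vector t01 zq)).
  by apply/forallP => j; apply/eqP; move: j; exact/is_quantile_vectorP.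
split=> [[Qx xmax]|xq].
  have [y yq] := quantile_vector_exists (quantile_level_gt0_lt1 d t01).
  have := xmax y (Qset_quantile_vector t01 yq).
  rewrite -(ler_pM2l rsd0) (quantile_max _ yq) => p_ge1.
  have [p_le1 p_eq1] := Qset_comparable_prob_le t01 Qx.
  apply/is_quantile_vectorP => // j; apply/eqP; move: j; apply/forallP.
  by rewrite -p_eq1 eq_le p_le1.
split=> [|y Qy]; first exact: Qset_quantile_vector.
by rewrite -(ler_pM2l rsd0) (quantile_max _ xq) (Qset_comparable_prob_le t01 Qy).
Qed.

Lemma comparable_prob_partial_quantile tau x : 0 < tau < 1 ->
  partial_quantile_point X tau x -> comparable_prob X x = 1 / root_sum d tau ^+ d.
Proof.
move=> t01 xq; have rsd0 : 0 < root_sum d tau ^+ d by rewrite exprn_gt0// root_sum_gt0.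
have [Qx _] := xq; apply: (mulfI (lt0r_neq0 rsd0)).
rewrite mul1r mulfV ?gt_eqF//; apply/eqP.
rewrite (Qset_comparable_prob_le t01 Qx); apply/forallP => j; apply/eqP; move: j.
exact/is_quantile_vectorP/partial_quantile_pointP.
Qed.

(** * Monotonicity of quantiles and the coordinatewise comparison *)

Lemma quantile_vector_le u v x y : is_quantile_vector X u x ->
  is_quantile_vector X v y -> u < v -> vle x y.
Proof.
move=> /(is_quantile_vectorP _ _ Xatom) xu /(is_quantile_vectorP _ _ Xatom) yv uv j.
rewrite leNgt; apply/negP => /ltW/(margin_cdf_le j).
by rewrite xu yv leNgt uv.
Qed.

(** Two quantile vectors of one level may be ordered either way, so the case [u = v] rests on [q]
    being a single choice. *)
Lemma quantile_function_le q u v : quantile_function X q ->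
  0 < u < 1 -> 0 < v < 1 -> u <= v -> vle (q u) (q v).
Proof.
move=> qq u01 v01; rewrite le_eqVlt => /orP[/eqP ->|uv]; first by move=> j.
exact: quantile_vector_le (qq _ u01) (qq _ v01) uv.
Qed.

Lemma quantile_level_dist_le q tau j : quantile_function X q -> 0 < tau < 1 ->
  `|tnth (q (quantile_level d tau)) j - tnth (q 2^-1) j| <=
  `|tnth (q tau) j - tnth (q 2^-1) j|.
Proof.
move=> qq t01; have l01 := quantile_level_gt0_lt1 d t01.
have h01 : 0 < (2^-1 : R) < 1 by apply/andP; split; lra.
have qle u v (u01 : 0 < u < 1) (v01 : 0 < v < 1) uv := quantile_function_le qq u01 v01 uv j.
have /andP[t0 t1] := t01.
have [th|/ltW th] := leP tau 2^-1.
  have /andP[tl lh] := quantile_level_le_half d0 t0 th.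
  have := qle _ _ t01 l01 tl; have := qle _ _ l01 h01 lh => h1 h2.
  by rewrite !ler0_norm; lra.
have /andP[hl lt] := quantile_level_ge_half d0 th t1.
have := qle _ _ h01 l01 hl; have := qle _ _ l01 t01 lt => h1 h2.
by rewrite !ger0_norm; lra.
Qed.

End RandomVector.

Unset Implicit Arguments.

Theorem theorem8 (R : realType) (dT : measure_display)
    (T : measurableType dT) (P : probability T R) (d : nat)
    (X : {RV P >-> d.-tuple R}) :
  (0 < d)%N ->
  no_point_mass X ->
  independent_components X ->
  (forall tau : R, 0 < tau < 1 ->
    [/\ exists x, partial_quantile_point X tau x,
        forall x, partial_quantile_point X tau x <->
                  is_quantile_vector X (quantile_level d tau) x
      & forall x, partial_quantile_point X tau x ->
                  comparable_prob X x = 1 / root_sum d tau ^+ d]) /\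
  (forall x, partial_quantile_point X 2^-1 x <->
             is_quantile_vector X 2^-1 x) /\
  (forall x : R -> d.-tuple R,
    (forall tau, 0 < tau < 1 -> partial_quantile_point X tau (x tau)) ->
    (exists q, quantile_function X q /\
       forall tau, 0 < tau < 1 -> x tau = q (quantile_level d tau)) /\
    (forall q, quantile_function X q ->
       (forall tau, 0 < tau < 1 -> x tau = q (quantile_level d tau)) ->
       x 2^-1 = q 2^-1 /\
       forall (k : \bar R) (tau : R), (1 <= k)%E -> 0 < tau < 1 ->
         ell_dist k (x tau) (x 2^-1) <= ell_dist k (q tau) (q 2^-1))).
Proof.
move=> d0 Xatom Xindep.
have h01 : 0 < (2^-1 : R) < 1 by apply/andP; split; lra.
split; [move=> tau t01; split|split].
- have [x xq] := quantile_vector_exists X (quantile_level_gt0_lt1 d t01).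
  by exists x; apply/partial_quantile_pointP.
- by move=> x; exact: partial_quantile_pointP.
- by move=> x; exact: comparable_prob_partial_quantile.
- move=> x; rewrite -[X in is_quantile_vector _ X _](quantile_level_half d0).
  exact: partial_quantile_pointP.
move=> x xq; split.
  (* Since the level map is a bijection of ]0, 1[, a choice of partial quantile points, reindexed by
     level, is itself a version of the quantile function. *)
  exists (fun u => x (inv_quantile_level d u)); split=> [u u01|tau t01].
    have t01 := inv_quantile_level_gt0_lt1 d u01.
    rewrite -[X in is_quantile_vector _ X _](inv_quantile_levelK d0 u01).
    exact/partial_quantile_pointP/xq.
  by rewrite quantile_levelK.
move=> q qq xqE; have xh : x 2^-1 = q 2^-1 by rewrite xqE// quantile_level_half.
split=> // k tau k1 t01; rewrite xh xqE//.
by apply: ell_dist_le => // j; exact: quantile_level_dist_le.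
Qed.
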